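(* Let $\mathcal{K}=\{x\in\mathbb{R}^n : g_i(x)\ge 0,\ i=1,\dots,m\}$, where $g_1,\dots,g_m$ are real multivariate polynomials, be compact with non-empty interior, and let $\mathcal{B}\subset\mathbb{R}^n$ be a compact set containing $\mathcal{K}$. For $d\in\mathbb{N}$ let $$v_d^* := \inf\{\mathrm{vol}\,\mathcal{U}(p) : p\in P_d,\ \mathcal{K}\subseteq\mathcal{U}(p)\}.$$ Then the sequence $(v_d^* )_d$ converges monotonically from above to $\mathrm{vol}\,\mathcal{K}$; that is, $v_d^*\ge v_{d+1}^*$ for all $d\ge 1$, and $\lim_{d\to\infty}v_d^*=\mathrm{vol}\,\mathcal{K}$.
   Context: $P_d$ denotes the set of real polynomials in $n$ variables of degree at most $d$. For a polynomial $p$, the polynomial superlevel set is $\mathcal{U}(p):=\{x\in\mathcal{B} : p(x)\ge 1\}$. $\mathrm{vol}$ denotes Lebesgue measure on $\mathbb{R}^n$. *)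

(* Defs.v *)
From HB Require Import structures.
From mathcomp Require Import all_boot all_order all_algebra.
From mathcomp Require Import all_classical all_reals all_analysis.
From mathcomp Require mpoly.
(* The notations of [mpoly] clash with those of the analysis library. *)
Import (canonicals, coercions) mpoly.
Import Order.TTheory GRing.Theory Num.Theory.
Import numFieldNormedType.Exports.

Set Implicit Arguments.
Unset Strict Implicit.
Unset Printing Implicit Defensive.

Local Open Scope classical_set_scope.
Local Open Scope ring_scope.

Definition tcons {T : Type} {n : nat} (xt : T * n.-tuple T) : n.+1.-tuple T :=
  [tuple of xt.1 :: xt.2].

(* Lebesgue measure on the product sigma-algebra of R^n (the Borel sets),
   obtained by iterating the binary product measure. *)
Fixpoint lebesgue_tuple (R : realType) (n : nat) :
    set (n.-tuple (measurableTypeR R)) -> \bar R :=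
  match n with
  | 0 => \d_([tuple] : 0.-tuple (measurableTypeR R))
  | m.+1 => pushforward
      (product_measure1 (@lebesgue_measure R) (@lebesgue_tuple R m)) tcons
  end.

Section sigma_finite_pack.
Context d (T : measurableType d) (R : realType).
Variables (k : {measure set T -> \bar R}) (kfin : sigma_finite setT k).

Let k' := k : set T -> \bar R.
HB.instance Definition _ := Measure.on k'.
HB.instance Definition _ := Measure_isSigmaFinite.Build _ _ _ k' kfin.

Lemma sigma_finite_pack :
  exists K : {sigma_finite_measure set T -> \bar R}, k = K :> (set T -> \bar R).
Proof. by exists k'. Qed.
End sigma_finite_pack.

Lemma sigma_finite_product1 d1 d2 (T1 : measurableType d1)
    (T2 : measurableType d2) (R : realType)
    (m1 : {sigma_finite_measure set T1 -> \bar R})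
    (m2 : {sigma_finite_measure set T2 -> \bar R}) :
  exists nu : {sigma_finite_measure set (T1 * T2)%type -> \bar R},
    product_measure1 m1 m2 = nu.
Proof.
have pfin : sigma_finite setT (product_measure1 m1 m2).
  have /sigma_finiteP[F [TF ndF Foo]] := sigma_finiteT m1.
  have /sigma_finiteP[G [TG ndG Goo]] := sigma_finiteT m2.
  exists (fun k => F k `*` G k).
    rewrite -setXTT TF TG predeqE => -[x y]; split.
      move=> [/= [i _ Fix] [j _ Gjy]]; exists (maxn i j) => //; split.
      - by move: x Fix; exact/subsetPset/ndF/leq_maxl.
      - by move: y Gjy; exact/subsetPset/ndG/leq_maxr.
    by move=> [i _ []/= ? ?]; split; exists i.
  move=> k; have [? ?] := Foo k; have [? ?] := Goo k.
  split; first exact: measurableX.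
  by rewrite product_measure1E// lte_mul_pinfty// ge0_fin_numE.
exact: sigma_finite_pack pfin.
Qed.

Lemma sigma_finite_pushforward_can d1 d2 (T1 : measurableType d1)
    (T2 : measurableType d2) (R : realType)
    (m : {sigma_finite_measure set T1 -> \bar R}) (f : T1 -> T2) (g : T2 -> T1) :
  measurable_fun setT f -> measurable_fun setT g -> cancel f g ->
  exists nu : {sigma_finite_measure set T2 -> \bar R}, pushforward m f = nu.
Proof.
move=> mf mg fK.
pose k : {measure set T2 -> \bar R} :=
  measure_function_pushforward__canonical__measure_function_Measure m mf.
have kfin : sigma_finite setT k.
  have [F FT Fm] := sigma_finiteT m.
  exists (fun i => g @^-1` F i); first by rewrite -preimage_bigcup -FT.
  move=> i; have [mF Foo] := Fm i; split.
    by rewrite -[X in measurable X]setTI; exact: mg.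
  rewrite /k /= /pushforward -comp_preimage.
  rewrite (_ : _ \o _ = id) ?preimage_id//.
  by apply/funext => x; exact: fK.
exact: sigma_finite_pack kfin.
Qed.

Section lebesgue_tuple_measure.
Variable R : realType.
Local Notation RR := (measurableTypeR R).

Let tuncons n (t : n.+1.-tuple RR) : RR * n.-tuple RR :=
  (thead t, [tuple of behead t]).

Let tconsK n : cancel (@tcons RR n) (@tuncons n).
Proof. by move=> [x t]; congr pair; apply/val_inj. Qed.

Lemma measurable_tcons n :
  measurable_fun [set: RR * n.-tuple RR] (@tcons RR n).
Proof. by apply: measurable_cons. Qed.

Let measurable_tuncons n :
  measurable_fun [set: n.+1.-tuple RR] (@tuncons n).
Proof.
apply: measurable_fun_pair; last exact: measurable_behead.
exact: measurable_tnth.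
Qed.

Lemma sigma_finite_lebesgue_tuple n :
  exists mu : {sigma_finite_measure set (n.-tuple RR) -> \bar R},
    @lebesgue_tuple R n = mu.
Proof.
elim: n => [|n [mu muE]].
  by exists (\d_([tuple] : 0.-tuple RR)).
have [nu nuE] := sigma_finite_product1 (@lebesgue_measure R) mu.
have [k kE] := sigma_finite_pushforward_can nu (@measurable_tcons n)
  (@measurable_tuncons n) (@tconsK n).
by exists k; rewrite /= muE nuE.
Qed.

Let lebesgue_tuple0 n : @lebesgue_tuple R n set0 = 0%E.
Proof. by have [mu ->] := sigma_finite_lebesgue_tuple n. Qed.

Let lebesgue_tuple_ge0 n A : (0 <= @lebesgue_tuple R n A)%E.
Proof. by have [mu ->] := sigma_finite_lebesgue_tuple n. Qed.

Let lebesgue_tuple_sigma_additive n : semi_sigma_additive (@lebesgue_tuple R n).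
Proof.
have [mu ->] := sigma_finite_lebesgue_tuple n.
exact: measure_semi_sigma_additive.
Qed.

HB.instance Definition _ n := isMeasure.Build _ _ _ (@lebesgue_tuple R n)
  (lebesgue_tuple0 n) (lebesgue_tuple_ge0 (n := n))
  (@lebesgue_tuple_sigma_additive n).

Let lebesgue_tuple_sigma_finite n : sigma_finite setT (@lebesgue_tuple R n).
Proof.
by have [mu ->] := sigma_finite_lebesgue_tuple n; exact: sigma_finiteT.
Qed.

HB.instance Definition _ n := Measure_isSigmaFinite.Build _ _ _
  (@lebesgue_tuple R n) (@lebesgue_tuple_sigma_finite n).

Lemma lebesgue_tuple_box n (A : 'I_n -> set RR) :
  (forall i, measurable (A i)) ->
  lebesgue_tuple [set t : n.-tuple RR | forall i, A i (tnth t i)] =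
  (\prod_(i < n) lebesgue_measure (A i))%E.
Proof.
elim: n A => [|n IH] A mA.
  rewrite big_ord0 /= diracE mem_set//=; by case.
rewrite big_ord_recl /= /pushforward.
pose B := [set t : n.-tuple RR | forall i, A (lift ord0 i) (tnth t i)].
have mB : measurable B.
  rewrite (_ : B = \bigcap_(i : 'I_n) ((@tnth n RR)^~ i @^-1` A (lift ord0 i))).
    apply: fin_bigcap_measurable => // i _.
    by rewrite -[X in measurable X]setTI; exact: measurable_tnth.
  by apply/seteqP; split=> t /= h i => [_|]; exact: h.
rewrite (_ : tcons @^-1` _ = A ord0 `*` B); last first.
  apply/seteqP; split=> -[x t] /=.
    move=> h; split; first exact: (h ord0).
    by move=> i; have := h (lift ord0 i); rewrite tnthS.
  by move=> [Ax Bt] i; case: (unliftP ord0 i) => [j ->|->//]; rewrite tnthS.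
by rewrite product_measure1E//; congr (_ * _)%E; exact: IH.
Qed.

End lebesgue_tuple_measure.

Definition tuple_row {T : Type} {n : nat} (t : n.-tuple T) : 'rV[T]_n :=
  \row_(i < n) tnth t i.

(* Tuples carry the product sigma-algebra, row vectors the Euclidean topology;
   only Borel sets are meant to be measured. *)
Definition vol (R : realType) (n : nat) (A : set 'rV[R]_n) : \bar R :=
  @lebesgue_tuple R n (tuple_row @^-1` A).

Lemma vol_box (R : realType) (n : nat) (A : 'I_n -> set (measurableTypeR R)) :
  (forall i, measurable (A i)) ->
  vol [set x : 'rV[R]_n | forall i, A i (x ord0 i)] =
  (\prod_(i < n) lebesgue_measure (A i))%E.
Proof.
move=> mA; rewrite -lebesgue_tuple_box// /vol; congr (lebesgue_tuple _).
by apply/seteqP; split=> t /= h i; have := h i; rewrite mxE.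
Qed.

Definition mpeval (R : realType) (n : nat) (p : mpoly.mpoly n R)
    (x : 'rV[R]_n) : R :=
  mpoly.meval (fun i => x ord0 i) p.

(* [mpoly.msize p] is 1 + deg p, and 0 for the zero polynomial. *)
Definition polys_deg_le (R : realType) (n d : nat) : set (mpoly.mpoly n R) :=
  [set p | (mpoly.msize p <= d.+1)%N].

Definition semialgebraic_set (R : realType) (n m : nat)
    (g : 'I_m -> mpoly.mpoly n R) : set 'rV[R]_n :=
  [set x | forall i, 0 <= mpeval (g i) x].

Definition superlevel (R : realType) (n : nat) (B : set 'rV[R]_n)
    (p : mpoly.mpoly n R) : set 'rV[R]_n :=
  [set x | B x /\ 1 <= mpeval p x].

Definition vstar (R : realType) (n : nat) (K B : set 'rV[R]_n) (d : nat) :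
    \bar R :=
  ereal_inf [set vol (superlevel B p) | p in
    [set p | polys_deg_le d p /\ K `<=` superlevel B p]].

(* Main.v *)
Require Import Defs.
From mathcomp Require Import all_boot all_order all_algebra.
From mathcomp Require Import all_classical all_reals all_analysis.
From mathcomp Require mpoly.
From mathcomp Require Import ring lra.
Import (canonicals, coercions) mpoly.
Import Order.TTheory GRing.Theory Num.Theory.
Import numFieldNormedType.Exports.

Local Open Scope classical_set_scope.
Local Open Scope ring_scope.

(** The lower bound [vol K <= vstar K B d] is monotonicity of the measure, and
    [vstar] is nonincreasing in [d] because the polynomials of degree at most
    [d] increase with [d].  Everything rests on the upper bound: polynomials
    [p] with [p >= 1] on [K] whose superlevel sets in [B] are hardly larger
    than [K].

    The description of [K] by inequalities makes such polynomials explicit,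
    with no appeal to a density theorem.  Let [M > 0] bound every [|g i|] on
    [B], and put
      [p_k := 1 + \sum_i (1 - (1 - g i / M) ^+ k)].
    On [B] the bases [1 - g i / M] are nonnegative, and on [K] they also lie
    below [1], so that [p_k >= 1] there.  Conversely, where [p_k >= 1] on [B],
    the powers sum to at most [m], so each of them is at most [m]; by
    Bernoulli's inequality a power at most [m] forces [g i >= - m * M / k].
    Hence for every [e > 0] some [p_k] has its superlevel set inside the
    relaxation [{x in B | g i x >= - e for all i}] (lemma
    [separating_mpoly]).

    As [e] decreases to [0] these relaxations shrink to [K], and continuity
    from above of the measure, applicable because the compact set [B] has
    finite volume, makes their volumes tend to [vol K] (lemma
    [cvg_vol_relaxation]).

    All sets measured above are closed.  That closed sets of row vectors are
    measurable for the product sigma-algebra on tuples comes from writing an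
    open set as a countable union of boxes with rational endpoints. *)

(** * Separating polynomials *)

Lemma bernoulli_le_exp (R : realDomainType) (y : R) (k : nat) :
  0 <= 1 + y -> 1 + k%:R * y <= (1 + y) ^+ k.
Proof.
move=> y1; elim: k => [|k IHk]; first by rewrite mul0r addr0 expr0.
rewrite exprS; apply: le_trans (ler_wpM2l y1 IHk).
rewrite -subr_ge0 [X in 0 <= X](_ : _ = k%:R * y ^+ 2).
  by rewrite mulr_ge0 // sqr_ge0.
rewrite -natr1; ring.
Qed.

Lemma compact_family_bounded (R : realType) (V : topologicalType) (I : finType)
    (f : I -> V -> R) (B : set V) :
  compact B -> (forall i, continuous (f i)) ->
  exists2 M : R, 0 < M & forall i x, B x -> `|f i x| <= M.
Proof.
move=> cB cf.
have /choice[M MP] (i : I) :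
    exists M : R, 0 < M /\ forall x, B x -> `|f i x| <= M.
  have /ex_strict_bound_gt0[M M0 fM] : bounded_set (f i @` B).
    apply: compact_bounded; apply: continuous_compact => //.
    exact: continuous_subspaceT.
  by exists M; split=> // x Bx; apply/ltW/fM; exists x.
exists (1 + \sum_i M i) => [|i x Bx].
  by rewrite ltr_pwDl // sumr_ge0 // => i _; apply/ltW; have [] := MP i.
have [_ /(_ x Bx) fM] := MP i; apply: le_trans fM _.
rewrite (bigD1 i) //= addrCA lerDl addr_ge0 // sumr_ge0 // => j _.
by apply/ltW; have [] := MP j.
Qed.

Lemma continuous_mpeval (R : realType) (n : nat) (p : mpoly.mpoly n R) :
  continuous (mpeval p).
Proof.
rewrite (_ : mpeval p = fun x => \sum_(a <- mpoly.msupp p)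
    mpoly.mcoeff a p * \prod_i x ord0 i ^+ mpoly.fun_of_multinom a i);
  last first.
  by apply/funext => x; exact: mpoly.mevalE.
apply: continuous_big => [|a _]; first exact: add_continuous.
have cX : continuous (fun x : 'rV[R]_n =>
    \prod_i x ord0 i ^+ mpoly.fun_of_multinom a i).
  apply: continuous_big => [|i _ x]; first exact: mul_continuous.
  apply: (@continuous_comp _ _ _ (fun x : 'rV[R]_n => x ord0 i)
    (fun y => y ^+ _)); first exact: coord_continuous.
  exact: exprn_continuous.
by move=> x; exact: (cvgM (cvg_cst _) (cX x)).
Qed.

Definition relaxation (R : realType) (n m : nat) (g : 'I_m -> mpoly.mpoly n R)
    (B : set 'rV[R]_n) (e : R) : set 'rV[R]_n :=
  [set x | B x /\ forall i, - e <= mpeval (g i) x].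
Arguments relaxation {R n m} g B e.

(** The witness is [1 + \sum_i (1 - (1 - g i / M) ^+ k)]: each summand is
    nonnegative where [0 <= g i <= M], whereas a single power exceeding [m]
    drags the sum below [0], the powers being nonnegative on [B]. *)
Lemma separating_mpoly (R : realType) (n m : nat) (g : 'I_m -> mpoly.mpoly n R)
    (B : set 'rV[R]_n) (e : R) :
  compact B -> 0 < e -> exists p : mpoly.mpoly n R,
    (forall x, B x -> semialgebraic_set g x -> 1 <= mpeval p x) /\
    superlevel B p `<=` relaxation g B e.
Proof.
move=> cB e0.
have [M M0 gM] := compact_family_bounded _ _ _ _ _ cB
  (fun i => continuous_mpeval _ _ (g i)).
(* With this [k], the error [m * M / k] of the bound below is at most [e]. *)
pose k := (Num.truncn (m%:R * M / e)).+1.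
have kP : m%:R * M <= k%:R * e.
  by rewrite -ler_pdivrMr // ltW // /k truncnS_gt.
pose p : mpoly.mpoly n R := 1 + \sum_(i < m) (1 - (1 - M^-1 *: g i) ^+ k).
have pE x : mpeval p x = 1 + \sum_(i < m) (1 - (1 - mpeval (g i) x / M) ^+ k).
  rewrite /mpeval /p mpoly.mevalD mpoly.meval1 raddf_sum /=; congr (1 + _).
  apply: eq_bigr => i _.
  by rewrite mpoly.mevalB mpoly.meval1 rmorphXn /= mpoly.mevalB mpoly.meval1
    mpoly.mevalZ mulrC.
have gM1 i x : B x -> -1 <= mpeval (g i) x / M <= 1.
  by move=> /(gM i); rewrite ler_norml ler_pdivrMr // ler_pdivlMr // mulN1r mul1r.
exists p; split=> x.
  move=> Bx Kx; rewrite pE lerDl sumr_ge0 // => i _.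
  have /andP[_ h] := gM1 i x Bx.
  have gi0 : 0 <= mpeval (g i) x / M by apply: divr_ge0; [exact: Kx|exact: ltW].
  by rewrite subr_ge0; apply: exprn_ile1; rewrite ?subr_ge0 ?gerBl.
move=> [Bx]; rewrite pE lerDl sumrB sumr_const card_ord subr_ge0 => sumle.
split=> // i.
have a0 j : 0 <= 1 - mpeval (g j) x / M.
  by have /andP[_ h] := gM1 j x Bx; rewrite subr_ge0.
have h : 1 - k%:R * (mpeval (g i) x / M) <= m%:R.
  rewrite -mulrN; apply: le_trans (bernoulli_le_exp _ _ _ (a0 i)) _.
  apply: le_trans sumle; rewrite (bigD1 i) //= lerDl sumr_ge0 // => j _.
  exact: exprn_ge0.
have k0 : 0 < k%:R :> R by rewrite ltr0n.
rewrite -(ler_pM2l k0) mulrN; apply: le_trans (_ : - (m%:R * M) <= _).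
  by rewrite lerN2.
rewrite -[mpeval (g i) x](divfK (lt0r_neq0 M0)) mulrA -mulNr.
by apply: ler_wpM2r; [exact: ltW|lra].
Qed.

(** * Measurability and volume of closed sets *)

Lemma measurable_tuple_box (R : realType) (n : nat)
    (A : 'I_n -> set (measurableTypeR R)) :
  (forall i, measurable (A i)) ->
  measurable [set t : n.-tuple (measurableTypeR R) | forall i, A i (tnth t i)].
Proof.
move=> mA.
rewrite (_ : mkset _ = \bigcap_(i : 'I_n)
    ((@tnth n (measurableTypeR R))^~ i @^-1` A i)).
  apply: fin_bigcap_measurable => // i _.
  by rewrite -[X in measurable X]setTI; exact: measurable_tnth.
by apply/seteqP; split=> t /= h i => [_|]; exact: h.
Qed.

(** An open set is the union of the boxes with rational endpoints that it
    contains; there are countably many, indexed by [{ffun 'I_n -> rat * rat}]. *)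
Lemma measurable_tuple_row_open (R : realType) (n : nat) (U : set 'rV[R]_n) :
  open U ->
  measurable (tuple_row @^-1` U : set (n.-tuple (measurableTypeR R))).
Proof.
move=> oU.
pose box (q : {ffun 'I_n -> rat * rat}) : set 'rV[R]_n :=
  [set x | forall i, x ord0 i \in `](ratr (q i).1), (ratr (q i).2)[ ].
pose F q := [set t : n.-tuple (measurableTypeR R) |
  box q (tuple_row t) /\ box q `<=` U].
rewrite (_ : _ @^-1` _ = \bigcup_q F q).
  apply: countable_bigcupT_measurable => // q.
  have [qU|nqU] := pselect (box q `<=` U); last first.
    by rewrite (_ : F q = set0) //; apply/seteqP; split=> // t [].
  rewrite (_ : F q = [set t | forall i,
    `](ratr (q i).1 : R), (ratr (q i).2)[%classic (tnth t i)]).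
    apply: (measurable_tuple_box _ _ (fun i =>
      `](ratr (q i).1 : R), (ratr (q i).2)[%classic)) => i.
    exact: measurable_itv.
  apply/seteqP; split=> t /=.
    by move=> [bt _] i; move: (bt i); rewrite mxE.
  by move=> h; split=> // i; rewrite mxE; exact: h.
apply/seteqP; split=> [t|t [q _ [bt]]]; last exact.
set x := tuple_row t => Ux.
have /nbhs_ballP[e /= e0 xeU] := open_nbhs_nbhs (conj oU Ux).
have /choice[q xq] (i : 'I_n) : exists q : rat * rat,
    [/\ x ord0 i - e < ratr q.1, ratr q.1 < x ord0 i,
        x ord0 i < ratr q.2 & ratr q.2 < x ord0 i + e].
  have /rat_in_itvoo[q1] : x ord0 i - e < x ord0 i by rewrite ltrBlDr ltrDl.
  have /rat_in_itvoo[q2] : x ord0 i < x ord0 i + e by rewrite ltrDl.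
  by rewrite !in_itv/= => /andP[? ?] /andP[? ?]; exists (q1, q2).
exists [ffun i => q i] => //; split.
  by move=> i; rewrite ffunE in_itv/=; have [_ -> -> _] := xq i.
move=> y yq; apply: xeU; split => // i j; rewrite ord1.
move: (yq j); rewrite ffunE in_itv/= => /andP[y1 y2].
have [x1 _ _ x2] := xq j.
rewrite -ball_normE /= ltr_norml; apply/andP; split; lra.
Qed.

Lemma measurable_tuple_row_closed (R : realType) (n : nat) (C : set 'rV[R]_n) :
  closed C ->
  measurable (tuple_row @^-1` C : set (n.-tuple (measurableTypeR R))).
Proof.
move=> cC; rewrite -[C]setCK preimage_setC; apply: measurableC.
exact: (measurable_tuple_row_open _ _ _ (closed_openC cC)).
Qed.

(** Closedness serves to make both sets measurable: monotonicity is not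
    available on arbitrary sets. *)
Lemma vol_le (R : realType) (n : nat) (A C : set 'rV[R]_n) :
  closed A -> closed C -> A `<=` C -> (vol A <= vol C)%E.
Proof.
move=> cA cC AC; apply: le_measure; rewrite ?inE.
- exact: measurable_tuple_row_closed.
- exact: measurable_tuple_row_closed.
- exact: preimage_subset.
Qed.

(** A compact set lies in a cube, whose volume is a finite product. *)
Lemma vol_compact_lty (R : realType) (n : nat) (B : set 'rV[R]_n) :
  compact B -> (vol B < +oo)%E.
Proof.
move=> cB.
have [M M0 BM] := compact_family_bounded _ _ _
  (fun (i : 'I_n) (x : 'rV[R]_n) => x ord0 i) _ cB
  (fun i => @coord_continuous _ _ _ ord0 i).
pose C := [set x : 'rV[R]_n | forall i, `[-M, M]%classic (x ord0 i)].
have vC : (vol C < +oo)%E.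
  rewrite /C (@vol_box R n (fun=> `[-M, M]%classic)); last first.
    by move=> i; exact: measurable_itv.
  rewrite ltey_eq prode_fin_num // => i _.
  by rewrite lebesgue_measure_itv; case: ifP.
apply: le_lt_trans vC; apply: le_measure; rewrite ?inE.
- apply: measurable_tuple_row_closed.
  by apply: compact_closed => //; exact: norm_hausdorff.
- rewrite (_ : _ @^-1` _ = [set t : n.-tuple (measurableTypeR R) |
    forall i, `[-M, M]%classic (tnth t i)]).
    apply: (measurable_tuple_box _ _ (fun=> `[-M, M]%classic)) => i.
    exact: measurable_itv.
  by apply/seteqP; split=> t /= h i; have := h i; rewrite mxE.
- by move=> t /= Bt i /=; rewrite in_itv/= -ler_norml; exact: BM.
Qed.

(** * Volumes of the relaxations *)

Lemma closed_mpeval_ge (R : realType) (n : nat) (p : mpoly.mpoly n R) (c : R) :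
  closed [set x | c <= mpeval p x].
Proof.
apply: (@preimage_closed _ _ (mpeval p) [set y | c <= y]).
  by move=> x _; exact: continuous_mpeval.
exact: closed_ge.
Qed.

Lemma closed_relaxation (R : realType) (n m : nat)
    (g : 'I_m -> mpoly.mpoly n R) (B : set 'rV[R]_n) (e : R) :
  closed B -> closed (relaxation g B e).
Proof.
move=> clB; rewrite (_ : relaxation g B e =
  B `&` \bigcap_i [set x | - e <= mpeval (g i) x]).
  by apply: closedI => //; apply: closed_bigI => i _; exact: closed_mpeval_ge.
by apply/seteqP; split=> x [Bx gx]; split=> // i; [move=> _|]; exact: gx.
Qed.

(** Continuity from above of the measure; the finite volume of [B] supplies the
    finiteness that it requires. *)
Lemma cvg_vol_relaxation (R : realType) (n m : nat)
    (g : 'I_m -> mpoly.mpoly n R) (B : set 'rV[R]_n) :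
  compact B -> semialgebraic_set g `<=` B ->
  vol (relaxation g B k.+1%:R^-1) @[k --> \oo] --> vol (semialgebraic_set g).
Proof.
move=> cB KB; pose V k := relaxation g B k.+1%:R^-1.
have clB : closed B by apply: compact_closed => //; exact: norm_hausdorff.
have clV k : closed (V k) by exact: closed_relaxation.
have capV : \bigcap_k V k = semialgebraic_set g.
  apply/seteqP; split=> [x Vx i|x Kx k _]; last first.
    by split=> [|i]; [exact: KB|exact: le_trans (Kx i)].
  rewrite leNgt; apply/negP => gx0.
  have [k gk] : exists k, k.+1%:R^-1 < - mpeval (g i) x.
    exists (Num.truncn (- mpeval (g i) x)^-1).
    by rewrite invf_plt ?posrE ?ltr0n ?oppr_gt0 // truncnS_gt.
  by have [_ /(_ i)] := Vx k I; rewrite leNgt => /negP; apply; rewrite ltrNr.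
rewrite -capV /vol preimage_bigcap.
apply: nonincreasing_cvg_mu.
- apply: le_lt_trans (vol_compact_lty _ _ _ cB).
  by apply: (vol_le _ _ (V 0%N) B) => // x [].
- by move=> k; exact: (measurable_tuple_row_closed _ _ _ (clV k)).
- apply: bigcapT_measurable => k.
  exact: (measurable_tuple_row_closed _ _ _ (clV k)).
- move=> k l kl; apply/subsetPset => t [Bt gt]; split=> // i.
  apply: le_trans (gt i).
  by rewrite lerN2 lef_pV2 ?posrE ?ltr0n // ler_nat.
Qed.

(** * Convergence of the optimal volumes *)

Theorem theorem1 (R : realType) (n m : nat) (g : 'I_m -> mpoly.mpoly n R)
    (B : set 'rV[R]_n) :
  let K := semialgebraic_set g in
  compact K -> interior K !=set0 -> compact B -> K `<=` B ->
  (forall d : nat, (1 <= d)%N -> (vstar K B d.+1 <= vstar K B d)%E) /\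
  vstar K B d @[d --> \oo] --> vol K.
Proof.
move=> K cK _ cB KB.
have clB : closed B.
  by apply: compact_closed => //; exact: norm_hausdorff.
have clK : closed K.
  by apply: compact_closed => //; exact: norm_hausdorff.
have clS p : closed (superlevel B p).
  by apply: closedI => //; exact: closed_mpeval_ge.
have vstar_ni : {homo vstar K B : d1 d2 / (d1 <= d2)%N >-> (d2 <= d1)%E}.
  move=> d1 d2 d12; apply: ereal_inf_le_tmp => _ [p [pd Kp] <-].
  by exists p => //; split=> //; exact: leq_trans pd _.
split=> [d _|]; first exact: vstar_ni.
suff <- : ereal_inf (range (vstar K B)) = vol K.
  exact: ereal_nonincreasing_cvgn.
apply/eqP; rewrite eq_le; apply/andP; split.
  have volV := cvg_vol_relaxation R n m g B cB KB.
  rewrite -(cvg_lim _ volV) //.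
  apply: lime_ge; first by apply/cvg_ex; exists (vol K).
  apply: nearW => k.
  have k0 : 0 < k.+1%:R^-1 :> R by rewrite invr_gt0 ltr0n.
  have [p [Kp pV]] := separating_mpoly _ _ _ g B _ cB k0.
  apply: le_trans (_ : _ <= vstar K B (mpoly.msize p))%E _.
    by apply: ereal_inf_lbound; exists (mpoly.msize p).
  apply: le_trans (_ : _ <= vol (superlevel B p))%E _.
    (* The degree of [p] is [msize p - 1], so the bound [msize p] is ample. *)
    apply: ereal_inf_lbound; exists p => //; split; first exact: leqnSn.
    by move=> x Kx; split; [exact: KB|apply: Kp => //; exact: KB].
  by apply: vol_le => //; exact: closed_relaxation.
apply: le_ereal_inf_tmp => _ [d _ <-].
apply: le_ereal_inf_tmp => _ [p [_ Kp] <-].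
exact: vol_le.
Qed.
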